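(* Let $\mathfrak{g}$ be a Lie algebra, $(M,\bullet)$ a $\mathfrak{g}$-module and $T$ an $\mathcal{O}$-operator on $M$ over $\mathfrak{g}$. If $\Omega : \mathfrak{g} \to M$ is a solution of the strong Maurer-Cartan equation on the twilled Lie algebra $\mathfrak{g} \bowtie M^T$, then for all $k \geq 0$ the maps $T_k := (T \circ \Omega)^k \circ T : M\to\mathfrak{g}$ are $\mathcal{O}$-operators on $M$ over $\mathfrak{g}$, and they are pairwise compatible.
   Context: All vector spaces are over a field of characteristic $0$. An $\mathcal{O}$-operator on a $\mathfrak{g}$-module $(M,\bullet)$ over the Lie algebra $\mathfrak{g}$ is a linear map $T: M\to\mathfrak{g}$ with $[T(m),T(n)] = T(T(m)\bullet n - T(n)\bullet m)$ for all $m,n\in M$. Two $\mathcal{O}$-operators on $M$ over $\mathfrak{g}$ are compatible if their sum is also an $\mathcal{O}$-operator. If $T$ is an $\mathcal{O}$-operator, $[m,n]^T := T(m)\bullet n - T(n)\bullet m$ is a Lie bracket on $M$, and $M^T$ denotes the Lie algebra $(M,[~,~]^T)$. A twilled Lie algebra $\mathfrak{a}\bowtie\mathfrak{b}$ is a Lie algebra which is the direct sum, as a vector space, of two Lie subalgebras $\mathfrak{a},\mathfrak{b}$. Decomposing $[x,u] = x\bullet_1 u - u\bullet_2 x$ for $x\in\mathfrak{a},u\in\mathfrak{b}$ (with $x\bullet_1 u\in\mathfrak{b}$, $u\bullet_2 x\in\mathfrak{a}$) gives representations $\bullet_1$ of $\mathfrak{a}$ on $\mathfrak{b}$ and $\bullet_2$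 of $\mathfrak{b}$ on $\mathfrak{a}$. A linear map $\Omega:\mathfrak{a}\to\mathfrak{b}$ is a solution of the strong Maurer-Cartan equation on $\mathfrak{a}\bowtie\mathfrak{b}$ if $d_{\mathrm{CE}}\Omega = 0$ and $\frac12[\Omega,\Omega]_{\mu_2}=0$, where for $x,y\in\mathfrak{a}$: $(d_{\mathrm{CE}}\Omega)(x,y) = x\bullet_1\Omega(y) - y\bullet_1\Omega(x) - \Omega([x,y])$ and $\frac12[\Omega,\Omega]_{\mu_2}(x,y) = [\Omega(x),\Omega(y)] - \Omega(\Omega(x)\bullet_2 y) + \Omega(\Omega(y)\bullet_2 x)$. For an $\mathcal{O}$-operator $T$, $\mathfrak{g}\bowtie M^T$ is the twilled Lie algebra on $\mathfrak{g}\oplus M$ with bracket $[[(x,m),(y,n)]]^T = ([x,y] + m\,\overline{\bullet}\,y - n\,\overline{\bullet}\,x,\ x\bullet n - y\bullet m + [m,n]^T)$, where $m\,\overline{\bullet}\,x = [T(m),x] + T(x\bullet m)$ (here $\mathfrak a=\mathfrak g$, $\mathfrak b=M^T$, $\bullet_1=\bullet$, $\bullet_2=\overline{\bullet}$). *)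

(* Defs.v *)
From HB Require Import structures.
From mathcomp Require Import all_boot all_algebra.
Set Implicit Arguments.
Unset Strict Implicit.
Unset Printing Implicit Defensive.
Import GRing.Theory.
Local Open Scope ring_scope.

(* A Lie algebra is a pair of a vector space V, of arbitrary dimension, and a
   lieBracket V. The bracket is not attached canonically to the carrier, since
   one vector space may carry several brackets. *)
Record lieBracket (K : fieldType) (V : lmodType K) := LieBracket {
  lie :> V -> V -> V;
  lie_linearl : forall y, linear (lie^~ y);
  lie_linearr : forall x, linear (lie x);
  lie_alt : forall x, lie x x = 0;
  lie_jacobi : forall x y z,
    lie x (lie y z) + lie y (lie z x) + lie z (lie x y) = 0 }.

Record lieModule (K : fieldType) (g : lmodType K) (br : lieBracket g)
    (M : lmodType K) := LieModule {
  lact :> g -> M -> M;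
  lact_linearl : forall m, linear (lact^~ m);
  lact_linearr : forall x, linear (lact x);
  lact_lie : forall x y m,
    lact (br x y) m = lact x (lact y m) - lact y (lact x m) }.

Section Twilled.
Variables (K : fieldType) (a b : lmodType K).

(* The direct sum of the two subspaces is the external one: a is identified
   with the pairs (x, 0), and b with the pairs (0, u). *)
Record twilledLie := TwilledLie {
  tw_lie :> lieBracket (a * b)%type;
  tw_closedl : forall x y, (tw_lie (x, 0) (y, 0)).2 = 0;
  tw_closedr : forall u v, (tw_lie (0, u) (0, v)).1 = 0 }.

Variable W : twilledLie.

Definition tw_bra (x y : a) : a := (W (x, 0) (y, 0)).1.
Definition tw_brb (u v : b) : b := (W (0, u) (0, v)).2.

(* [x, u] = tw_act1 x u - tw_act2 u x *)
Definition tw_act1 (x : a) (u : b) : b := (W (x, 0) (0, u)).2.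
Definition tw_act2 (u : b) (x : a) : a := - (W (x, 0) (0, u)).1.

Definition dCE (Om : a -> b) (x y : a) : b :=
  tw_act1 x (Om y) - tw_act1 y (Om x) - Om (tw_bra x y).

(* (1/2) [Om, Om]_{mu_2} *)
Definition half_mu2 (Om : a -> b) (x y : a) : b :=
  tw_brb (Om x) (Om y) - Om (tw_act2 (Om x) y) + Om (tw_act2 (Om y) x).

Definition strong_MC (Om : a -> b) : Prop :=
  [/\ linear Om,
      forall x y, dCE Om x y = 0
    & forall x y, half_mu2 Om x y = 0].

End Twilled.

Section OOperator.
Variables (K : fieldType) (g M : lmodType K) (br : lieBracket g).
Variable act : lieModule br M.

Definition O_bracket (T : M -> g) (m n : M) : M := act (T m) n - act (T n) m.

Definition O_operator (T : M -> g) : Prop :=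
  linear T /\ forall m n, br (T m) (T n) = T (O_bracket T m n).

Definition O_compatible (T T' : M -> g) : Prop := O_operator (T \+ T').

Definition O_act2 (T : M -> g) (m : M) (x : g) : g := br (T m) x + T (act x m).

Definition O_tw_bracket (T : M -> g) (p q : g * M) : g * M :=
  (br p.1 q.1 + O_act2 T p.2 q.1 - O_act2 T q.2 p.1,
   act p.1 q.2 - act q.1 p.2 + O_bracket T p.2 q.2).

Definition O_iterate (T : M -> g) (Om : g -> M) (k : nat) : M -> g :=
  iter k (T \o Om) \o T.

End OOperator.

Section LinearFacts.
Variables (K : fieldType) (U V : lmodType K) (f : U -> V).
Hypothesis lf : linear f.
Let F : {linear U -> V} := HB.pack f (GRing.isLinear.Build K U V *:%R f lf).
Lemma lin0 : f 0 = 0. Proof. exact: (linear0 F). Qed.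
Lemma linD x y : f (x + y) = f x + f y. Proof. exact: (linearD F). Qed.
Lemma linN x : f (- x) = - f x. Proof. exact: (linearN F). Qed.
Lemma linB x y : f (x - y) = f x - f y. Proof. exact: (linearB F). Qed.
Lemma linZ c x : f (c *: x) = c *: f x. Proof. exact: (linearZ_LR F). Qed.
End LinearFacts.

Section LieFacts.
Variables (K : fieldType) (g M : lmodType K) (br : lieBracket g).
Variable act : lieModule br M.

Lemma lieDl x x' y : br (x + x') y = br x y + br x' y.
Proof. exact: (linD (lie_linearl br y)). Qed.
Lemma lieDr x y y' : br x (y + y') = br x y + br x y'.
Proof. exact: (linD (lie_linearr br x)). Qed.
Lemma lieNr x y : br x (- y) = - br x y.
Proof. exact: (linN (lie_linearr br x)). Qed.
Lemma lie0l y : br 0 y = 0.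
Proof. exact: (lin0 (lie_linearl br y)). Qed.
Lemma lie0r y : br y 0 = 0.
Proof. exact: (lin0 (lie_linearr br y)). Qed.
Lemma lieC x y : br x y = - br y x.
Proof.
have := lie_alt br (x + y).
by rewrite lieDl !lieDr !lie_alt add0r addr0 => /eqP; rewrite addr_eq0 => /eqP.
Qed.

Lemma lactDl x x' m : act (x + x') m = act x m + act x' m.
Proof. exact: (linD (lact_linearl act m)). Qed.
Lemma lactDr x m m' : act x (m + m') = act x m + act x m'.
Proof. exact: (linD (lact_linearr act x)). Qed.
Lemma lactBr x m m' : act x (m - m') = act x m - act x m'.
Proof. exact: (linB (lact_linearr act x)). Qed.
Lemma lact0l m : act 0 m = 0.
Proof. exact: (lin0 (lact_linearl act m)). Qed.
Lemma lact0r x : act x 0 = 0.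
Proof. exact: (lin0 (lact_linearr act x)). Qed.

Definition semidirect (p q : g * M) : g * M :=
  (br p.1 q.1, act p.1 q.2 - act q.1 p.2).

Lemma semidirect_linearl q : linear (semidirect^~ q).
Proof.
move=> c p p'; congr pair => /=; first exact: lie_linearl.
rewrite (lact_linearl act) (lact_linearr act) /= scalerBr opprD.
by rewrite addrACA.
Qed.

Lemma semidirect_alt p : semidirect p p = 0.
Proof. by rewrite /semidirect lie_alt subrr. Qed.

Lemma semidirectN p q : semidirect p q = - semidirect q p.
Proof.
by congr pair; [exact: lieC | rewrite /= opprB].
Qed.

Lemma semidirect_jacobi p q r :
  semidirect p (semidirect q r) + semidirect q (semidirect r p)
    + semidirect r (semidirect p q) = 0.
Proof.
have shuffle (a b c d : M) : a - b - (c - d) = (d + a) - (b + c).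
  by rewrite opprB opprD addrACA [a + d]addrC.
case: p q r => [x m] [y n] [z o]; congr pair => /=; first exact: lie_jacobi.
rewrite !lact_lie !lactBr !shuffle.
by rewrite !subrKA subrr.
Qed.

Variable T : M -> g.
Hypothesis hT : O_operator act T.

(* (x, m) |-> (x + T m, m) carries O_tw_bracket to the bracket of the
   semidirect product. *)
Definition O_phi (p : g * M) : g * M := (p.1 + T p.2, p.2).

Lemma O_phi_inj : injective O_phi.
Proof. by move=> [x m] [y n] [/= E mn]; move: E; rewrite mn => /addIr->. Qed.

Lemma O_phi_linear : linear O_phi.
Proof.
move=> c [x m] [y n]; congr pair => /=.
by case: hT => -> _; rewrite /= scalerDr addrACA.
Qed.

Lemma O_phi_bracket p q :
  O_phi (O_tw_bracket act T p q) = semidirect (O_phi p) (O_phi q).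
Proof.
case: p q hT => [x m] [y n] [Tl TO]; congr pair => /=; last first.
  rewrite /O_bracket !lactDl opprD -!addrA; congr (_ + _).
  by rewrite addrCA.
rewrite /O_act2 (linD Tl) (linB Tl) -TO lieDl !lieDr [br x (T n)]lieC.
rewrite opprD !addrA (addrAC _ (- T (act y m))) !subrK.
set a := br x y; set b := br _ _; set c := T _; set d := br _ _.
by rewrite (addrAC _ _ (- c)) (addrAC _ (- d) (- c)) addrK (addrAC a b).
Qed.

Lemma O_tw_linearl q : linear (O_tw_bracket act T ^~ q).
Proof.
move=> c p p'; apply: O_phi_inj.
by rewrite O_phi_linear !O_phi_bracket O_phi_linear semidirect_linearl.
Qed.

Lemma O_twN p q : O_tw_bracket act T p q = - O_tw_bracket act T q p.
Proof.
apply: O_phi_inj.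
by rewrite (linN O_phi_linear) !O_phi_bracket semidirectN.
Qed.

Lemma O_tw_linearr p : linear (O_tw_bracket act T p).
Proof.
move=> c q q'; rewrite O_twN O_tw_linearl /= opprD -scalerN.
by rewrite -!(O_twN p).
Qed.

Lemma O_tw_alt p : O_tw_bracket act T p p = 0.
Proof.
apply: O_phi_inj.
by rewrite (lin0 O_phi_linear) O_phi_bracket semidirect_alt.
Qed.

Lemma O_tw_jacobi p q r :
  O_tw_bracket act T p (O_tw_bracket act T q r)
  + O_tw_bracket act T q (O_tw_bracket act T r p)
  + O_tw_bracket act T r (O_tw_bracket act T p q) = 0.
Proof.
apply: O_phi_inj.
by rewrite (lin0 O_phi_linear) !(linD O_phi_linear) !O_phi_bracket
  semidirect_jacobi.
Qed.

Definition O_tw_lie : lieBracket (g * M)%type :=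
  LieBracket O_tw_linearl O_tw_linearr O_tw_alt O_tw_jacobi.

Lemma O_tw_closedl x y : (O_tw_lie (x, 0) (y, 0)).2 = 0.
Proof.
by rewrite /= /O_bracket !lact0r !subrr addr0.
Qed.

Lemma O_tw_closedr m n : (O_tw_lie (0, m) (0, n)).1 = 0.
Proof.
case: hT => Tl _.
by rewrite /= /O_act2 !lie0r !lact0l (lin0 Tl) !addr0 subr0.
Qed.

Definition O_twilled : twilledLie g M := TwilledLie O_tw_closedl O_tw_closedr.

Lemma O_twilledE :
  [/\ tw_bra O_twilled =2 br, tw_brb O_twilled =2 O_bracket act T,
      tw_act1 O_twilled =2 act & tw_act2 O_twilled =2 O_act2 act T].
Proof.
case: hT => Tl _; have T0 := lin0 Tl.
split=> [x y|m n|x m|m x]; rewrite /tw_bra /tw_brb /tw_act1 /tw_act2 /=.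
- by rewrite /O_act2 T0 !lact0r !lie0l T0 !addr0 subr0.
- by rewrite !lact0l subrr add0r.
- by rewrite /O_bracket T0 !lact0r lact0l !subr0 addr0.
- by rewrite /O_act2 lie0r lact0l T0 lie0l !addr0 add0r opprK.
Qed.

End LieFacts.

(* Main.v *)
Require Import Defs.
From mathcomp Require Import all_boot all_algebra.
Import GRing.Theory.
Local Open Scope ring_scope.

(* Put N = T Omega and S = Omega T, so that T_k = N^k T = T S^k. Applying T to
   the equation [Omega, Omega] = 0 and using the cocycle equation shows that N
   is a Nijenhuis operator, whence
     [N^i x, N^j y] + N^(i+j) [x, y] = N^i [x, N^j y] + N^j [N^i x, y].
   The two equations together also show that every Omega N^k is a cocycle, i.e.
   S^(k+1) [m, n]^T = T m . S^(k+1) n - T n . S^(k+1) m. With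
   E_ij(m, n) = T_i (T_j m . n - T m . S^j n) these give
     [T_i m, T_j n] = E_ji(m, n) - E_ij(n, m) + T_(i+j) [m, n]^T,
     T_i [m, n]^(T_j) = E_ij(m, n) - E_ij(n, m) + T_(i+j) [m, n]^T,
   and the O-operator and compatibility identities follow. *)

Lemma linear_iter {K : fieldType} {V : lmodType K} {f : V -> V} (k : nat) :
  linear f -> linear (iter k f).
Proof. by move=> lf; elim: k => [//|k IH c x y]; rewrite /= IH lf. Qed.

Lemma linear_comp {K : fieldType} {U V W : lmodType K} {f : V -> W}
  {h : U -> V} : linear f -> linear h -> linear (f \o h).
Proof. by move=> lf lh c x y; rewrite /= lh lf. Qed.

(** Adding the two equations, [b + c] cancels. This is the gluing step of both inductions on powers
    of [N] below. *)
Lemma addr_chain {V : zmodType} {a b c d e f : V} :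
  a + b = c + d -> c + e = b + f -> a + e = d + f.
Proof.
move=> Eab Ece; apply: (addIr (b + c)).
by rewrite addrACA Eab [e + c]addrC Ece [b + c]addrC [RHS]addrACA [c + d]addrC
  [b + f]addrC.
Qed.

Lemma subr_chain {V : zmodType} {p q r s z : V} :
  p - q + z = p - r + (s - q) -> z = s - r.
Proof.
move=> E; apply: (addrI (p - q)).
by rewrite E addrACA [RHS]addrACA [- r + - q]addrC.
Qed.

Section Nijenhuis.
Context {K : fieldType} {g : lmodType K} (br : lieBracket g) (N : g -> g).

Definition nijenhuis : Prop :=
  forall x y, br (N x) (N y) + N (N (br x y)) = N (br (N x) y) + N (br x (N y)).

Hypotheses (Nl : linear N) (NN : nijenhuis).

Lemma nijenhuis_iterr j x y :
  br (N x) (iter j N y) + iter j.+1 N (br x y)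
  = N (br x (iter j N y)) + iter j N (br (N x) y).
Proof.
elim: j => [|j IH]; first by rewrite /= addrC.
apply: (addr_chain (NN x (iter j N y))).
by rewrite -(linD Nl) IH (linD Nl).
Qed.

Lemma nijenhuis_iter i j x y :
  br (iter i N x) (iter j N y) + iter (i + j) N (br x y)
  = iter i N (br x (iter j N y)) + iter j N (br (iter i N x) y).
Proof.
elim: i => [//|i IH].
rewrite [RHS]addrC; apply: (addr_chain (nijenhuis_iterr j (iter i N x) y)).
by rewrite addSn /= -(linD Nl) IH (linD Nl) addrC.
Qed.

End Nijenhuis.

Section StrongMC.
Context {K : fieldType} {g M : lmodType K} {br : lieBracket g}.
Context {act : lieModule br M} {T : M -> g} {hT : O_operator act T}.
Context {Om : g -> M} (hOm : strong_MC (O_twilled hT) Om).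

Let N : g -> g := T \o Om.
Let S : M -> M := Om \o T.
Let Tl : linear T := proj1 hT.
Let Oml : linear Om. Proof. by case: hOm. Qed.
Let Nl : linear N := linear_comp Tl Oml.

Lemma strong_MC_cocycle x y : Om (br x y) = act x (Om y) - act y (Om x).
Proof.
case: hOm (O_twilledE hT) => _ /(_ x y) + _ [Ebr _ E1 _].
by rewrite /dCE Ebr !E1 => /subr0_eq.
Qed.

(** When the second action is expanded in [half_mu2], its two [T]-terms combine by the cocycle
    identity into [N (br x y)]. *)
Lemma strong_MC_bracket x y :
  O_bracket act T (Om x) (Om y) + Om (N (br x y))
  = Om (br (N x) y) + Om (br x (N y)).
Proof.
case: hOm (O_twilledE hT) => _ _ /(_ x y) + [_ Ebr _ E2].
rewrite /half_mu2 Ebr !E2 /O_act2 -/(N x) -/(N y) [br (N y) x]lieC => E.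
have -> : N (br x y) = T (act x (Om y)) - T (act y (Om x)).
  by rewrite /N /= strong_MC_cocycle (linB Tl).
rewrite !(linD Oml) (linN Oml) in E.
rewrite (linB Oml); apply: subr0_eq; rewrite -[RHS]E !opprD.
rewrite [LHS]addrACA -[RHS]addrA -[X in _ = _ + X]addrA [RHS]addrA.
congr (_ + _).
by rewrite -[LHS]addrA addrCA; congr (_ + _); rewrite addrC.
Qed.

Lemma strong_MC_nijenhuis : nijenhuis br N.
Proof.
move=> x y; rewrite {1 2}/N /= (proj2 hT) -(linD Tl) strong_MC_bracket.
by rewrite (linD Tl).
Qed.

Lemma strong_MC_cocycle_iter k x y :
  Om (iter k N (br x y)) = act x (Om (iter k N y)) - act y (Om (iter k N x)).
Proof.
(* Two consecutive powers are carried along, since the Nijenhuis identity links [N^k], [N^(k+1)] and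
   [N^(k+2)]. *)
suff [] : (forall x y, Om (iter k N (br x y))
             = act x (Om (iter k N y)) - act y (Om (iter k N x))) /\
          (forall x y, Om (iter k.+1 N (br x y))
             = act x (Om (iter k.+1 N y)) - act y (Om (iter k.+1 N x))) by [].
elim: k => [|k [IH0 IH1]]; split=> // {}x {}y.
- exact: strong_MC_cocycle.
- by have := strong_MC_bracket x y; rewrite !strong_MC_cocycle => /subr_chain.
rewrite ![iter k.+2 _ _]iterSr ![iter k.+1 _ _]iterSr.
have lk := linear_comp Oml (linear_iter k Nl).
(* The hypotheses for [k] and [k+1] expand every term but [Om (N^(k+2) [x, y])], and the terms
   acting by [N x] and [N y] cancel. *)
have /(congr1 (Om \o iter k N)) := strong_MC_nijenhuis x y.
rewrite !(linD lk) /= IH0 -!iterSr !IH1 !iterSr => E.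
exact: subr_chain E.
Qed.

Lemma iter_comp_swap k m : iter k N (T m) = T (iter k S m).
Proof. by elim: k => //= k ->. Qed.

Local Notation Tk := (O_iterate T Om).

Lemma linear_O_iterate k : linear (Tk k).
Proof. exact: linear_comp (linear_iter k Nl) Tl. Qed.

Lemma iter_O_bracket k m n :
  iter k S (O_bracket act T m n)
  = act (T m) (iter k S n) - act (T n) (iter k S m).
Proof.
(* Here [S^(k+1) = Om N^k T], and [T] turns [[m, n]^T] into [[T m, T n]], so the cocycle identity
   applies. *)
case: k => [//|k]; rewrite !iterS /S /= -!iter_comp_swap -(proj2 hT).
exact: strong_MC_cocycle_iter.
Qed.

Let E i j m n := Tk i (act (Tk j m) n - act (T m) (iter j S n)).

Lemma O_iterateD i j m : Tk (i + j) m = Tk i (iter j S m).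
Proof. by rewrite /O_iterate /= iterD iter_comp_swap. Qed.

Lemma O_iterate_O_bracket i j m n :
  Tk i (O_bracket act (Tk j) m n)
  = E i j m n - E i j n m + Tk (i + j) (O_bracket act T m n).
Proof.
rewrite O_iterateD iter_O_bracket /E -(linB (linear_O_iterate i)).
rewrite -(linD (linear_O_iterate i)) /O_bracket; congr (Tk i _).
by rewrite opprB addrAC !subrKA.
Qed.

Lemma lie_O_iterate i j m n :
  br (Tk i m) (Tk j n)
  = E j i m n - E i j n m + Tk (i + j) (O_bracket act T m n).
Proof.
have H1 : O_bracket act T m (iter j S n) = iter j S (O_bracket act T m n)
    - (act (Tk j n) m - act (T n) (iter j S m)).
  by rewrite iter_O_bracket /O_bracket -iter_comp_swap opprB subrKA.
have H2 : O_bracket act T (iter i S m) n = iter i S (O_bracket act T m n)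
    + (act (Tk i m) n - act (T m) (iter i S n)).
  by rewrite iter_O_bracket /O_bracket -iter_comp_swap [RHS]addrC subrKA.
(* This is the Nijenhuis identity for [N^i], [N^j] at [T m], [T n]. By [H1] and [H2] its right side
   contains [T_(i+j) [m, n]^T] twice, and one copy cancels. *)
have N1 : br (Tk i m) (Tk j n) + Tk (i + j) (O_bracket act T m n)
    = Tk i (O_bracket act T m (iter j S n))
      + Tk j (O_bracket act T (iter i S m) n).
  rewrite /O_iterate /= -!(proj2 hT) -!iter_comp_swap.
  exact: (nijenhuis_iter br N Nl strong_MC_nijenhuis).
apply: (addIr (Tk (i + j) (O_bracket act T m n))).
rewrite [LHS]N1 H1 H2.
rewrite (linB (linear_O_iterate i)) (linD (linear_O_iterate j)).
rewrite -!O_iterateD [(j + i)%N]addnC -/(E i j n m) -/(E j i m n).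
by rewrite -[RHS]addrA [RHS]addrC [_ - _ + _]addrC addrACA.
Qed.

End StrongMC.

Theorem corollary6p7 (K : fieldType) (charK : [pchar K] =i pred0)
    (g M : lmodType K) (br : lieBracket g) (act : lieModule br M)
    (T : M -> g) (hT : O_operator act T)
    (Omega : g -> M) (hOmega : strong_MC (O_twilled hT) Omega) :
  (forall k : nat, O_operator act (O_iterate T Omega k)) /\
  (forall k l : nat,
     O_compatible act (O_iterate T Omega k) (O_iterate T Omega l)).
Proof.
set Tk := O_iterate T Omega.
have Tkl : forall k, linear (Tk k) := linear_O_iterate hOmega.
have TkO k : O_operator act (Tk k).
  split=> // m n.
  (* For [i = j = k] the two expansions coincide. *)
  by rewrite /Tk (lie_O_iterate hOmega) (O_iterate_O_bracket hOmega).
split=> // k l; split=> [c m n|m n]; first by rewrite /= !Tkl scalerDr addrACA.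
(* Only the mixed terms of the identity for [T_k + T_l] remain. Single expansions differ when [k]
   and [l] do, but symmetrizing in [k, l] makes the [E] terms agree. *)
have cross : br (Tk k m) (Tk l n) + br (Tk l m) (Tk k n)
    = Tk k (O_bracket act (Tk l) m n) + Tk l (O_bracket act (Tk k) m n).
  rewrite /Tk !(lie_O_iterate hOmega) !(O_iterate_O_bracket hOmega).
  rewrite [(l + k)%N]addnC.
  rewrite [LHS]addrACA [RHS]addrACA; congr (_ + _).
  by rewrite addrACA [X in X + _ = _]addrC addrACA.
have -> : O_bracket act (Tk k \+ Tk l) m n
    = O_bracket act (Tk k) m n + O_bracket act (Tk l) m n.
  by rewrite /O_bracket /= !lactDl opprD addrACA.
rewrite [LHS]lieDl !lieDr (proj2 (TkO k)) (proj2 (TkO l)).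
rewrite [RHS]/= (linD (Tkl k)) (linD (Tkl l)) -[LHS]addrA [X in _ + X = _]addrA.
by rewrite cross -[X in _ + X = _]addrA [LHS]addrA.
Qed.
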